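(* Let $k\ge 1$ be a fixed integer and suppose $p=p(n)$ satisfies either $p^{k+1}n\to\infty$ or $p^k n\to 0$ as $n\to\infty$. Let $f_k$ be the number of $k$-dimensional faces of $X(n,p)$ and $\beta_k=\dim\widetilde H_k(X(n,p),\mathbb{Q})$. Then $E(\beta_k)/E(f_k)\to 0$.
   Context: $G(n,p)$ is the random graph on vertex set $[n]$ with each edge included independently with probability $p$. The clique complex $X(H)$ of a graph $H$ is the simplicial complex whose faces are the vertex sets of complete subgraphs of $H$; $X(n,p)$ denotes $X(G(n,p))$. $\widetilde H_k$ denotes reduced homology. *)

(* Defs.v *)
From HB Require Import structures.
From mathcomp Require Import all_boot all_order all_algebra.
Set Implicit Arguments.
Unset Strict Implicit.
Unset Printing Implicit Defensive.
Import Order.TTheory GRing.Theory Num.Theory.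
Local Open Scope ring_scope.

(** * Simplicial complexes on ['I_n] and reduced rational homology *)

(* A complex is given by its set of faces, the empty face included. *)
Definition is_complex n (K : {set {set 'I_n}}) : Prop :=
  set0 \in K /\ forall s t : {set 'I_n}, s \in K -> t \subset s -> t \in K.

Definition faces n (K : {set {set 'I_n}}) (k : nat) : {set {set 'I_n}} :=
  [set s in K | #|s| == k.+1].

(* Chains of the full simplex on ['I_n], all degrees together. The empty set
   spans degree -1, which makes the homology below reduced. Each simplex is
   oriented by the order of ['I_n]. *)
Notation chain n := {ffun {set 'I_n} -> rat^o}.

Definition simplex n (s : {set 'I_n}) : chain n := [ffun t => (t == s)%:R].

Definition rank_in n (s : {set 'I_n}) (v : 'I_n) : nat :=
  #|[set u in s | (u < v)%N]|.

(* [v_0 ... v_m] |-> \sum_i (-1)^i [v_0 ... (omit v_i) ... v_m] *)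
Definition simplex_boundary n (s : {set 'I_n}) : chain n :=
  \sum_(v in s) (-1) ^+ rank_in s v *: simplex (s :\ v).

Definition boundary_fun n (c : chain n) : chain n :=
  \sum_(s : {set 'I_n}) c s *: simplex_boundary s.

Fact boundary_fun_linear n : linear (@boundary_fun n).
Proof.
move=> a c d; rewrite /boundary_fun scaler_sumr -big_split /=.
by apply: eq_bigr => s _; rewrite !ffunE scalerDl scalerA.
Qed.

HB.instance Definition _ n :=
  GRing.isLinear.Build rat (chain n) (chain n) _ (@boundary_fun n)
    (@boundary_fun_linear n).

Definition boundary n : 'End(chain n) := linfun (@boundary_fun n).

Definition chains n (K : {set {set 'I_n}}) (k : nat) : {vspace chain n} :=
  span [seq simplex s | s <- enum (faces K k)].

Definition cycles n (K : {set {set 'I_n}}) (k : nat) : {vspace chain n} :=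
  (chains K k :&: lker (boundary n))%VS.

Definition boundaries n (K : {set {set 'I_n}}) (k : nat) : {vspace chain n} :=
  (boundary n @: chains K k.+1)%VS.

(* The quotient of cycles by boundaries, realised as a complement; see
   [homologyP] and [bettiE]. *)
Definition homology n (K : {set {set 'I_n}}) (k : nat) : {vspace chain n} :=
  (cycles K k :\: boundaries K k)%VS.

Definition betti n (K : {set {set 'I_n}}) (k : nat) : nat := \dim (homology K k).

Lemma boundary_simplex n (s : {set 'I_n}) :
  boundary n (simplex s) = simplex_boundary s.
Proof.
rewrite /boundary lfunE /= /boundary_fun (bigD1 s) //= ffunE eqxx scale1r.
by rewrite big1 ?addr0 // => t /negbTE nts; rewrite ffunE nts scale0r.
Qed.

Lemma rank_inD1 n (s : {set 'I_n}) (u v : 'I_n) : u \in s ->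
  rank_in s v = ((u < v)%N + rank_in (s :\ u) v)%N.
Proof.
move=> us; rewrite /rank_in (cardsD1 u) inE us /=; congr (_ + _)%N.
by apply: eq_card => w; rewrite !inE andbA.
Qed.

Lemma boundaryK n (c : chain n) : boundary n (boundary n c) = 0.
Proof.
have H s : boundary n (simplex_boundary s) = 0.
  rewrite /simplex_boundary linear_sum /=.
  under eq_bigr => v _ do rewrite linearZ /= boundary_simplex scaler_sumr.
  pose F u v : chain n := (-1) ^+ rank_in s u *:
    ((-1) ^+ rank_in (s :\ u) v *: simplex (s :\ u :\ v)).
  have FN u v : u \in s -> v \in s -> u != v -> F u v = - F v u.
    move=> us vs uv; rewrite /F !scalerA -!exprD -scaleNr.
    have -> : s :\ u :\ v = s :\ v :\ u by apply/setP=> w; rewrite !inE andbCA.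
    congr (_ *: _); rewrite (rank_inD1 _ vs) (rank_inD1 v us).
    move: (rank_in (s :\ v) u) (rank_in (s :\ u) v) => a b.
    case: (ltngtP u v) => [||/val_inj/eqP]; last by rewrite (negbTE uv).
    - by move=> _; rewrite add0n add1n addSn exprS mulN1r opprK addnC.
    - by move=> _; rewrite add0n add1n addSn exprS mulN1r addnC.
  have E : \sum_(u in s) \sum_(v in s :\ u) F u v =
           - \sum_(u in s) \sum_(v in s :\ u) F u v.
    rewrite [LHS](exchange_big_dep (mem s)) /=; last first.
      by move=> u v _; rewrite inE => /andP[].
    rewrite -sumrN; apply: eq_bigr => v vs; rewrite -sumrN.
    rewrite (eq_bigl (mem (s :\ v))); last first.
      by move=> u; rewrite !inE vs andbT eq_sym andbC.
    by apply: eq_bigr => u; rewrite !inE => /andP[uv us]; exact: FN.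
  move/eqP: E; rewrite -addr_eq0 -mulr2n -scaler_nat scaler_eq0 pnatr_eq0 /=.
  by move/eqP.
rewrite [X in boundary n X](lfunE (@boundary_fun n)) /boundary_fun linear_sum /=.
by apply: big1 => s _; rewrite linearZ /= H scaler0.
Qed.

Lemma sub_boundaries_cycles n (K : {set {set 'I_n}}) k :
  is_complex K -> (boundaries K k <= cycles K k)%VS.
Proof.
move=> [_ Kdown]; rewrite subv_cap; apply/andP; split; last first.
  by apply/subvP => _ /memv_imgP[c _ ->]; rewrite memv_ker boundaryK.
rewrite /boundaries limg_span; apply/span_subvP => _ /mapP[_ /mapP[s + ->] ->].
rewrite mem_enum inE => /andP[sK /eqP s_card]; rewrite boundary_simplex.
apply: memv_suml => v vs; apply: memvZ; apply: memv_span; apply: map_f.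
rewrite mem_enum inE (Kdown s) ?subsetDl //=.
by have := cardsD1 v s; rewrite vs s_card add1n => -[<-].
Qed.

Lemma bettiE n (K : {set {set 'I_n}}) k : is_complex K ->
  betti K k = (\dim (cycles K k) - \dim (boundaries K k))%N.
Proof.
move=> /(@sub_boundaries_cycles _ _ k)/capv_idPr BZ.
by rewrite /betti -(dimv_cap_compl (cycles K k) (boundaries K k)) BZ addKn.
Qed.

Lemma homologyP n (K : {set {set 'I_n}}) k : is_complex K ->
  exists f : 'End(chain n), (f @: cycles K k)%VS = homology K k /\
    (cycles K k :&: lker f)%VS = boundaries K k.
Proof.
move=> /(@sub_boundaries_cycles _ _ k) BZ.
pose B := boundaries K k; pose H := homology K k.
have HB : (H :&: B = 0)%VS by exact: capv_diff.
have ZE : (H + B = cycles K k)%VS.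
  by rewrite -(addv_diff_cap (cycles K k) B) (capv_idPr BZ).
exists (daddv_pi H B); rewrite -ZE.
have fH h : h \in H -> daddv_pi H B h = h by exact: daddv_pi_id.
have fB b : b \in B -> daddv_pi H B b = 0.
  move=> bB; have := daddv_pi_add HB (subvP (addvSr H B) _ bB).
  rewrite (daddv_pi_id _ bB) ?[(B :&: H)%VS]capvC //.
  by rewrite -[RHS]add0r => /addIr.
split.
  apply/eqP; rewrite eqEsubv; apply/andP; split.
    by apply/subvP => _ /memv_imgP[c _ ->]; exact: memv_pi.
  apply/subvP => h hH; apply/memv_imgP; exists h; last by rewrite fH.
  exact: subvP (addvSl H B) _ hH.
apply/eqP; rewrite eqEsubv; apply/andP; split; last first.
  by rewrite subv_cap addvSr /=; apply/subvP => b /fB fb0; rewrite memv_ker fb0.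
apply/subvP => c; rewrite memv_cap memv_ker => /andP[/memv_addP[h hH [b bB ->]]].
by rewrite linearD /= fH // fB // addr0 => /eqP ->; rewrite add0r.
Qed.

(** * Random clique complexes *)

Definition pairs n : {set {set 'I_n}} := [set e : {set 'I_n} | #|e| == 2].

(* A graph on ['I_n] is its edge set, a subset of [pairs n]. *)
Definition graphs n : {set {set {set 'I_n}}} := powerset (pairs n).

Definition clique_complex n (G : {set {set 'I_n}}) : {set {set 'I_n}} :=
  [set s : {set 'I_n} |
    [forall u in s, forall v in s, (u != v) ==> ([set u; v] \in G)]].

Lemma clique_complex_is_complex n (G : {set {set 'I_n}}) :
  is_complex (clique_complex G).
Proof.
split=> [|s t].
  by rewrite inE; apply/forall_inP => u; rewrite inE.
rewrite !inE => /forall_inP sG /fintype.subsetP ts.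
apply/forall_inP => u /ts us; apply/forall_inP => v /ts vs.
by have /forall_inP := sG u us; apply.
Qed.

Section Gnp.
Context {R : realFieldType}.

Definition gnp_prob n (p : R) (G : {set {set 'I_n}}) : R :=
  \prod_(e in pairs n) (if e \in G then p else 1 - p).

Definition gnp_expectation n (p : R) (X : {set {set 'I_n}} -> R) : R :=
  \sum_(G in graphs n) gnp_prob p G * X G.

Lemma gnp_prob_ge0 n (p : R) (G : {set {set 'I_n}}) :
  0 <= p <= 1 -> 0 <= gnp_prob p G.
Proof.
move=> /andP[p0 p1]; apply: prodr_ge0 => e _.
by case: ifP; rewrite // subr_ge0.
Qed.

(* Edges are present independently, each with probability [p]; the case
   [A = set0] says that the total mass is 1. *)
Lemma gnp_prob_edges n (p : R) (A : {set {set 'I_n}}) : A \subset pairs n ->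
  gnp_expectation p (fun G => (A \subset G)%:R) = p ^+ #|A|.
Proof.
move=> Apairs; have ApE e : e \in A -> e \in pairs n by exact/subsetP.
pose F e : R := if e \in pairs n then p else 0.
pose F' e : R := if e \in pairs n then (if e \in A then 0 else 1 - p) else 1.
transitivity (\prod_(e : {set 'I_n}) (F e + F' e)); last first.
  rewrite (bigID (mem A)) /= [X in _ * X]big1 ?mulr1 => [|e eA].
    rewrite -prodr_const; apply: eq_bigr => e eA.
    by rewrite /F /F' (ApE _ eA) eA addr0.
  rewrite /F /F' (negbTE eA).
  by case: ifP => _; rewrite ?add0r // addrC subrK.
rewrite bigA_distr /gnp_expectation [RHS](bigID (mem (graphs n))) /=.
rewrite [X in _ + X]big1 ?addr0 => [|G].
  apply: eq_bigr => G; rewrite inE => /subsetP Gpairs.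
  case: (boolP (A \subset G)) => [/subsetP AG|/subsetPn[e eA eG]].
    rewrite mulr1 /gnp_prob big_mkcond /=; apply: eq_bigr => e _.
    rewrite /F /F'; case: (boolP (e \in pairs n)) => ep.
      by case: (boolP (e \in G)) => // eG; rewrite ifN //; apply: contra eG => /AG.
    by rewrite ifN //; apply: contra ep => /Gpairs.
  by rewrite mulr0 (bigD1 e) //= (negbTE eG) /F' ApE // eA mul0r.
rewrite inE => /subsetPn[e eG ep].
by rewrite (bigD1 e) //= eG /F (negbTE ep) mul0r.
Qed.

Definition expected_faces n (p : R) (k : nat) : R :=
  gnp_expectation p
    (fun G : {set {set 'I_n}} => #|faces (clique_complex G) k|%:R).

Definition expected_betti n (p : R) (k : nat) : R :=
  gnp_expectation p
    (fun G : {set {set 'I_n}} => (betti (clique_complex G) k)%:R).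

End Gnp.

(* Main.v *)
Require Import Defs.
From mathcomp Require Import all_boot all_order all_algebra.
From mathcomp Require Import all_classical all_reals all_analysis.
From mathcomp Require Import ring.
Import Order.TTheory GRing.Theory Num.Theory.
Import numFieldNormedType.Exports.
Local Open Scope ring_scope.

(* If [p^k n -> 0]: a k-face in the support of a cycle shares a facet with
   another k-face, so [betti] is at most the number of k-faces s for which some
   vertex outside s is adjacent to all but one of the vertices of s. By the union
   bound their expected proportion is at most [(k+1) n p^k].

   If [p^(k+1) n -> +oo]: let A be a set of M vertices. A k-face s disjoint from
   A with a common neighbour v in A is, up to the boundary of [v |: s], a
   combination of faces through v. Hence the faces that meet A or have no common
   neighbour in A span the k-chains modulo boundaries, and [betti] is at most
   their number. The first kind has proportion at most [(k+1) M / n]; by the second moment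
   method the second has expected proportion at most [1 / (M p^(k+1))]. Take for
   M a small fixed proportion of n. *)

Section Combinatorics.
Set Implicit Arguments.
Unset Strict Implicit.
Unset Printing Implicit Defensive.

(** * Edge sets of cliques and of stars *)

Section CliqueEdges.
Variable n : nat.
Implicit Types (s t : {set 'I_n}) (u v w : 'I_n) (G : {set {set 'I_n}}).

(** Being a face becomes an inclusion of an edge set in [G], the kind of event whose probability
    [gnp_prob_edges] computes. *)
Definition clique_edges s : {set {set 'I_n}} := [set e in pairs n | e \subset s].

Definition star s v : {set {set 'I_n}} := [set [set u; v] | u in s].

Lemma clique_complexE G s :
  (s \in clique_complex G) = (clique_edges s \subset G).
Proof.
rewrite inE; apply/forall_inP/fintype.subsetP => [H e|H u us].
  rewrite !inE => /andP[/cards2P[u [v [uv ->]]]].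
  rewrite finset.subUset !finset.sub1set => /andP[us vs].
  by have /forall_inP/(_ v vs) := H u us; rewrite uv.
apply/forall_inP => v vs; apply/implyP => uv; apply: H.
by rewrite !inE cards2 uv finset.subUset !finset.sub1set us vs.
Qed.

Lemma clique_edgesU1 s v :
  clique_edges (v |: s) \subset clique_edges s :|: star s v.
Proof.
apply/fintype.subsetP => e; rewrite !inE => /andP[e2]; rewrite e2 /=.
move/cards2P: e2 => [a [b [ab ->]]].
rewrite !finset.subUset !finset.sub1set !inE => /andP[] /orP[/eqP Ea|sa] /orP[/eqP Eb|sb].
- by rewrite Ea Eb eqxx in ab.
- by apply/orP; right; apply/imsetP; exists b; rewrite // Ea finset.setUC.
- by apply/orP; right; apply/imsetP; exists a; rewrite // Eb.
- by rewrite sa sb.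
Qed.

Lemma star_sub_clique_edges s v : v \notin s -> star s v \subset clique_edges (v |: s).
Proof.
move=> vs; apply/fintype.subsetP => _ /imsetP[u us ->].
rewrite !inE cards2 finset.subUset !finset.sub1set !inE us eqxx orbT.
by rewrite (_ : u != v) //; apply: contraNneq vs => <-.
Qed.

Lemma card_clique_edges s : #|clique_edges s| = 'C(#|s|, 2).
Proof.
rewrite -cards_draws; apply: eq_card => e.
by rewrite !inE andbC.
Qed.

Lemma card_star s v : v \notin s -> #|star s v| = #|s|.
Proof.
move=> vs; apply: card_in_imset => a b sa sb /setP/(_ a).
rewrite !inE eqxx /= => /esym/orP[/eqP //|/eqP av].
by rewrite -av sa in vs.
Qed.

Lemma star_subpairs s v : v \notin s -> star s v \subset pairs n.
Proof.
move=> vs; apply/fintype.subsetP => _ /imsetP[u us ->].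
by rewrite !inE cards2 (_ : u != v) //; apply: contraNneq vs => <-.
Qed.

Lemma clique_edges_subpairs s : clique_edges s \subset pairs n.
Proof. by apply/fintype.subsetP => e; rewrite inE => /andP[]. Qed.

(** An edge inside [s] avoids [v]. Disjointness of edge families makes the exponents of [p] add up,
    which is how independence enters below. *)
Lemma disjoint_edges_star s t v : v \notin s -> [disjoint clique_edges s & star t v].
Proof.
move=> vs; rewrite disjoint_subset; apply/fintype.subsetP => e; rewrite !inE.
move=> /andP[_ es]; apply/imsetP => -[u _ E].
by move: es; rewrite E finset.subUset !finset.sub1set (negbTE vs) andbF.
Qed.

Lemma disjoint_star s v w : v \notin s -> v != w -> [disjoint star s v & star s w].
Proof.
move=> vs vw; rewrite disjoint_subset; apply/fintype.subsetP => _ /imsetP[u us ->].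
apply/imsetP => -[u' us' /setP/(_ v)]; rewrite !inE eqxx orbT (negbTE vw) orbF.
by move=> /esym/eqP vu; rewrite vu us' in vs.
Qed.

Lemma cardsU_disjoint (T : finType) (A B : {set T}) :
  [disjoint A & B] -> #|A :|: B| = (#|A| + #|B|)%N.
Proof. by move=> AB; rewrite cardsU finset.disjoint_setI0 ?cards0 ?subn0. Qed.

Lemma facesE G k s :
  (s \in faces (clique_complex G) k) = (#|s| == k.+1) && (clique_edges s \subset G).
Proof. by rewrite inE clique_complexE andbC. Qed.

End CliqueEdges.

(** * Deterministic upper bounds on the Betti number *)

Section Homology.
Variable n : nat.
Implicit Types (s t : {set 'I_n}) (u v w : 'I_n) (G K : {set {set 'I_n}}).

Lemma dim_span_simplex (P : {set {set 'I_n}}) :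
  (\dim <<[seq @simplex n s | s <- enum P]>> <= #|P|)%N.
Proof. by apply: leq_trans (dim_span _) _; rewrite size_map -cardE. Qed.

Lemma simplex_boundaryE s u : u \in s ->
  simplex_boundary s (s :\ u) = (-1) ^+ rank_in s u.
Proof.
move=> us; rewrite /simplex_boundary sum_ffunE (bigD1 u) //= !ffunE eqxx.
rewrite big1 ?addr0 => [|v /andP[vs vu]]; first by rewrite /GRing.scale /= mulr1.
rewrite !ffunE (_ : (s :\ u == s :\ v) = false) ?scaler0 //.
apply/negP => /eqP/setP/(_ v); rewrite !inE vu vs eqxx //.
Qed.

Lemma simplex_boundary_neq0 s t : simplex_boundary s t != 0 ->
  exists2 v, v \in s & t = s :\ v.
Proof.
move=> H; case: (pickP (fun v => (v \in s) && (t == s :\ v))) => [v|N].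
  by move=> /andP[vs /eqP ->]; exists v.
case/negP: H; rewrite /simplex_boundary sum_ffunE big1 // => v vs.
by rewrite !ffunE; move: (N v); rewrite vs /= => ->; rewrite scaler0.
Qed.

Lemma chainsP K k (c : chain n) s :
  c \in chains K k -> s \notin faces K k -> c s = 0.
Proof.
move=> /coord_span-> sK; rewrite sum_ffunE big1 // => i _.
have ilt : (i < size (enum (faces K k)))%N by rewrite -cardE.
rewrite !ffunE (nth_map finset.set0) // !ffunE; set t := nth _ _ _.
have tK : t \in faces K k by rewrite -mem_enum; apply: mem_nth.
rewrite (_ : (s == t) = false) ?scaler0 //.
by apply/negP => /eqP st; rewrite st tK in sK.
Qed.

Lemma chain_sum (c : chain n) : c = \sum_s c s *: simplex s.
Proof.
apply/ffunP => t; rewrite sum_ffunE (bigD1 t) //= !ffunE eqxx big1.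
  by rewrite addr0 /GRing.scale /= mulr1.
by move=> s st; rewrite !ffunE eq_sym (negbTE st) scaler0.
Qed.

Lemma betti_le_adjacent G k :
  (betti (clique_complex G) k <=
   #|[set s in faces (clique_complex G) k |
      [exists u in s, exists w in ~: s, star (s :\ u) w \subset G]]|)%N.
Proof.
set K := clique_complex G; set A := [set s in _ | _].
apply: leq_trans (dim_span_simplex A).
apply: dimvS; apply: subv_trans (diffvSl _ _) _.
apply/subvP => c; rewrite memv_cap memv_ker => /andP[cK /eqP c0].
rewrite [c]chain_sum; apply: memv_suml => s _.
case: (eqVneq (c s) 0) => [->|cs]; first by rewrite scale0r mem0v.
apply/memvZ/memv_span/map_f; rewrite mem_enum.
have sK : s \in faces K k by apply: contraNT cs => /(chainsP cK) ->.
have [u us] : exists u, u \in s.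
  by apply/card_gt0P; move: sK; rewrite inE => /andP[_ /eqP->].
(* By contraposition: without such a vertex, [s] is the only face in the support of [c] having
   [s :\ u] as a facet, so the boundary of [c] has coefficient [c s] there, up to sign. *)
rewrite inE sK /=; apply: contraNT cs => iso.
have: boundary n c (s :\ u) = 0 by rewrite c0 ffunE.
rewrite /boundary lfunE /= /boundary_fun sum_ffunE (bigD1 s) //= !ffunE.
rewrite simplex_boundaryE // big1 ?addr0 => [/eqP|t ts].
  by rewrite scaler_eq0 signr_eq0 orbF.
rewrite !ffunE; case: (boolP (t \in faces K k)) => tK; last first.
  by rewrite (chainsP cK tK) scale0r.
case: (eqVneq (simplex_boundary t (s :\ u)) 0) => [->|]; first by rewrite scaler0.
move=> /simplex_boundary_neq0[v vt E]; case/negP: iso.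
have vsu : v \notin s :\ u by rewrite E !inE eqxx.
(* If [v] were in [s] it would be [u], and restoring it to the common facet would give [t = s]. *)
have vs : v \notin s.
  apply/negP => vs; move: vsu; rewrite !inE vs andbT negbK => /eqP vu.
  by rewrite -(finset.setD1K vt) -E vu finset.setD1K ?eqxx in ts.
apply/exists_inP; exists u => //; apply/exists_inP; exists v; first by rewrite inE.
apply: fintype.subset_trans (star_sub_clique_edges vsu) _.
by rewrite E finset.setD1K //; move: tK; rewrite facesE => /andP[].
Qed.

Lemma betti_le_cone G k (A : {set 'I_n}) :
  (betti (clique_complex G) k <=
   #|[set s in faces (clique_complex G) k |
      ~~ [disjoint s & A] || [forall v in A, ~~ (star s v \subset G)]]|)%N.
Proof.
set K := clique_complex G; set C := [set s in _ | _].
pose S : {vspace chain n} := <<[seq @simplex n s | s <- enum C]>>%VS.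
have CB : (chains K k <= boundaries K k + S)%VS.
  apply/span_subvP => _ /mapP[s + ->]; rewrite mem_enum => sK.
  have [sC|] := boolP (s \in C).
    by apply: (subvP (addvSr _ _)); apply/memv_span/map_f; rewrite mem_enum.
  rewrite inE sK /= negb_or negbK => /andP[sA].
  rewrite negb_forall_in => /exists_inP[v vA]; rewrite negbK => vG.
  have vs : v \notin s.
    by apply: contraL sA => vs; apply/pred0Pn; exists v; rewrite /= vs vA.
  have tK : v |: s \in faces K k.+1.
    move: sK; rewrite !facesE cardsU1 vs => /andP[/eqP-> sG]; rewrite add1n eqxx /=.
    by apply: fintype.subset_trans (clique_edgesU1 _ _) _; rewrite finset.subUset sG.
  have : simplex_boundary (v |: s) \in (boundaries K k + S)%VS.
    apply: (subvP (addvSl _ _)); rewrite -boundary_simplex; apply: memv_img.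
    by apply/memv_span/map_f; rewrite mem_enum.
  rewrite /simplex_boundary (bigD1 v) ?inE ?eqxx //= finset.setU1K //.
  (* The other facets of [v |: s] still contain [v], which lies in [A], so they belong to [C]. *)
  rewrite rpredDr => [|]; last first.
    apply: memv_suml => w /andP[wt wv]; apply/memvZ/(subvP (addvSr _ _)).
    apply/memv_span/map_f; rewrite mem_enum inE.
    apply/andP; split; last first.
      apply/orP; left; apply/pred0Pn; exists v.
      by rewrite /= !inE eqxx vA eq_sym wv.
    move: tK; rewrite [_ \in faces _ k.+1]inE => /andP[tK tc].
    rewrite inE (proj2 (clique_complex_is_complex G) _ _ tK (finset.subsetDl _ _)) /=.
    by move: tc; rewrite (cardsD1 w) wt.
  (* Multiplying by the sign once more leaves [simplex s] itself. *)
  move=> /(memvZ ((-1) ^+ rank_in (v |: s) v)); rewrite scalerA -exprD addnn.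
  by rewrite -mul2n exprM sqrrN !expr1n scale1r.
(* The complement realising homology meets the boundaries trivially, so adding
   [\dim (boundaries K k)] to both sides turns the claim into a comparison of sums of subspaces. *)
have HB : (homology K k :&: boundaries K k = 0)%VS by exact: capv_diff.
rewrite /betti -(leq_add2r (\dim (boundaries K k))) -dimv_disjoint_sum //.
apply: leq_trans (_ : _ <= \dim (boundaries K k + S))%N _.
  apply: dimvS; rewrite subv_add addvSl andbT.
  apply: subv_trans CB; apply: subv_trans (diffvSl _ _) _; exact: capvSl.
apply: leq_trans (dimv_add_leqif _ _) _.
by rewrite addnC leq_add2r dim_span_simplex.
Qed.

End Homology.

(** * Expectations of the face count and of the two bounds *)

Section Expectation.
Context {R : realFieldType}.
Variables (n k : nat) (p : R).
Hypothesis p01 : 0 <= p <= 1.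
Implicit Types (X Y : {set {set 'I_n}} -> R) (G : {set {set 'I_n}}).

Lemma le_gnp_expectation X Y :
  (forall G, X G <= Y G) -> gnp_expectation p X <= gnp_expectation p Y.
Proof.
by move=> XY; apply: ler_sum => G _; apply: ler_wpM2l => //; exact: gnp_prob_ge0.
Qed.

Lemma gnp_expectation_sum (I : finType) (P : pred I) (F : I -> {set {set 'I_n}} -> R) :
  gnp_expectation p (fun G => \sum_(i | P i) F i G) =
  \sum_(i | P i) gnp_expectation p (F i).
Proof.
rewrite /gnp_expectation exchange_big; apply: eq_bigr => G _.
by rewrite mulr_sumr.
Qed.

Lemma gnp_expectationD X Y :
  gnp_expectation p (fun G => X G + Y G) = gnp_expectation p X + gnp_expectation p Y.
Proof. by rewrite /gnp_expectation -big_split; apply: eq_bigr => G _; rewrite mulrDr. Qed.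

Lemma gnp_expectationZ a X :
  gnp_expectation p (fun G => a * X G) = a * gnp_expectation p X.
Proof. by rewrite /gnp_expectation mulr_sumr; apply: eq_bigr => G _; rewrite mulrCA. Qed.

Lemma card_faces_sum (P : pred {set 'I_n}) G :
  (#|[set s in faces (clique_complex G) k | P s]|)%:R =
  \sum_(s : {set 'I_n} | #|s| == k.+1) ((clique_edges s \subset G) && P s)%:R :> R.
Proof.
rewrite -sum1_card natr_sum [LHS]big_mkcond [RHS]big_mkcond; apply: eq_bigr => s _.
by rewrite inE facesE -andbA; case: (#|s| == _) => //=; case: (_ && _).
Qed.

Lemma card_ksubsets : #|[pred s : {set 'I_n} | #|s| == k.+1]| = 'C(n, k.+1).
Proof.
rewrite -[in RHS](card_ord n) -cardsT -cards_draws.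
by apply: eq_card => s; rewrite !inE finset.subsetT.
Qed.

Lemma expected_facesE :
  expected_faces n p k = 'C(n, k.+1)%:R * p ^+ 'C(k.+1, 2).
Proof.
rewrite /expected_faces.
transitivity (\sum_(s : {set 'I_n} | #|s| == k.+1) p ^+ 'C(k.+1, 2)).
  transitivity (gnp_expectation p (fun G : {set {set 'I_n}} =>
      \sum_(s : {set 'I_n} | #|s| == k.+1) (clique_edges s \subset G)%:R)).
    apply: eq_bigr => G _; congr (_ * _).
    transitivity (#|[set s in faces (clique_complex G) k | xpredT s]|%:R : R).
      by congr (_%:R); apply: eq_card => s; rewrite !inE andbT.
    by rewrite card_faces_sum; apply: eq_bigr => s _; rewrite andbT.
  rewrite gnp_expectation_sum; apply: eq_bigr => s /eqP sk.
  by rewrite gnp_prob_edges ?clique_edges_subpairs // card_clique_edges sk.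
by rewrite sumr_const card_ksubsets mulr_natl.
Qed.

(** Union bound over [s], the omitted vertex [u] and the outside vertex [w]: each triple requires
    ['C(k.+1, 2) + k] distinct edges. *)
Lemma expected_betti_le_adjacent :
  expected_betti n p k <= (k.+1%:R * (p ^+ k * n%:R)) * expected_faces n p k.
Proof.
rewrite expected_facesE; set e := 'C(k.+1, 2).
apply: le_trans (_ : \sum_(s : {set 'I_n} | #|s| == k.+1) \sum_(u in s)
    \sum_(w in ~: s) p ^+ (e + k) <= _); last first.
  rewrite (eq_bigr (fun=> (k.+1 * (n - k.+1))%:R * p ^+ (e + k))); last first.
    move=> s /eqP sk; rewrite !sumr_const.
    rewrite (_ : #|~: s| = n - k.+1)%N; last by rewrite cardsCs finset.setCK card_ord sk.
    by rewrite sk -mulrnA mulr_natl mulnC.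
  rewrite sumr_const card_ksubsets -[_ *+ _]mulr_natl.
  rewrite [X in _ <= X]mulrCA; apply: ler_wpM2l => //.
  rewrite exprD natrM -!mulrA; apply: ler_wpM2l => //.
  have [p0 _] := andP p01.
  rewrite [X in _ <= X]mulrCA (mulrC (p ^+ k)).
  by apply: ler_wpM2r; rewrite ?mulr_ge0 ?exprn_ge0 // ler_nat leq_subr.
pose Z (G : {set {set 'I_n}}) : R := \sum_(s : {set 'I_n} | #|s| == k.+1) \sum_(u in s)
    \sum_(w in ~: s) (clique_edges s :|: star (s :\ u) w \subset G)%:R.
apply: le_trans (_ : gnp_expectation p Z <= _).
  apply: le_gnp_expectation => G.
  apply: le_trans (_ : (#|[set s in faces (clique_complex G) k |
      [exists u in s, exists w in ~: s, star (s :\ u) w \subset G]]|)%:R <= _).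
    by rewrite ler_nat betti_le_adjacent.
  rewrite card_faces_sum; apply: ler_sum => s _.
  (* One witnessing pair [u], [w] already contributes 1 to the double sum. *)
  case: andP => [[sG /exists_inP[u us /exists_inP[w ws wG]]]|_]; last first.
    by apply: sumr_ge0 => u _; apply: sumr_ge0.
  rewrite (bigD1 u) //= (bigD1 w) //= finset.subUset sG wG -addrA lerDl addr_ge0 //.
    by apply: sumr_ge0.
  by apply: sumr_ge0 => v _; apply: sumr_ge0.
rewrite /Z gnp_expectation_sum; apply: ler_sum => s /eqP sk.
rewrite gnp_expectation_sum; apply: ler_sum => u us.
rewrite gnp_expectation_sum; apply: ler_sum => w; rewrite inE => ws.
have wsu : w \notin s :\ u by rewrite inE negb_and ws orbT.
rewrite gnp_prob_edges; last by rewrite finset.subUset clique_edges_subpairs star_subpairs.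
rewrite cardsU_disjoint ?disjoint_edges_star // card_clique_edges card_star //.
by move: sk; rewrite (cardsD1 u) us add1n => -[->].
Qed.

(** Such a set is [v |: t] with [v] in [A] and [t] a [k]-subset avoiding [v], so there are at most
    [#|A| * 'C(n.-1, k)] of them; [mul_bin_diag] turns [n * 'C(n.-1, k)] into
    [k.+1 * 'C(n, k.+1)]. *)
Lemma card_subsets_meeting (A : {set 'I_n}) :
  (n * #|[set s : {set 'I_n} | (#|s| == k.+1) && ~~ [disjoint s & A]]| <=
   #|A| * (k.+1 * 'C(n, k.+1)))%N.
Proof.
rewrite -mul_bin_diag mulnCA leq_mul2l; apply/orP; right.
rewrite -sum_nat_const.
apply: leq_trans (_ : #|\bigcup_(v in A) [set v |: t | t in
   [set t : {set 'I_n} | t \subset ~: [set v] & #|t| == k]]| <= _)%N.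
  apply/subset_leq_card/fintype.subsetP => s; rewrite inE => /andP[/eqP sk].
  case/pred0Pn => v /andP[/= vs vA]; apply/bigcupP; exists v => //.
  apply/imsetP; exists (s :\ v); last by rewrite finset.setD1K.
  rewrite inE finset.subsetDr /=; by move: sk; rewrite (cardsD1 v) vs add1n => -[->].
apply: leq_trans (_ : \sum_(v in A) #|[set v |: t | t in
   [set t : {set 'I_n} | t \subset ~: [set v] & #|t| == k]]| <= _)%N.
  elim/big_rec2: _ => [|v x y _ H]; first by rewrite cards0.
  by apply: leq_trans (leq_card_setU _ _) _; rewrite leq_add2l.
apply: leq_sum => v _; apply: leq_trans (leq_imset_card _ _) _.
by rewrite cards_draws cardsC1 card_ord.
Qed.

(* Second moment method: with N the number of common neighbours in A of the
   face s, [N = 0] <= (1 - N / E N)^2, where E N = #|A| * p^(k+1). *)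
Lemma expected_no_common_neighbour (A s : {set 'I_n}) :
    (0 < #|A|)%N -> 0 < p -> #|s| = k.+1 -> [disjoint s & A] ->
  gnp_expectation p (fun G =>
    ((clique_edges s \subset G) && [forall v in A, ~~ (star s v \subset G)])%:R)
  <= p ^+ 'C(k.+1, 2) * (#|A|%:R * p ^+ k.+1)^-1.
Proof.
move=> A0 p0 sk sA; set x := p ^+ _; set q := p ^+ k.+1; set m : R := #|A|%:R.
have AE v : v \in A -> v \notin s.
  by move=> vA; apply: contraL sA => vs; apply/pred0Pn; exists v; rewrite /= vs.
have m0 : 0 < m by rewrite ltr0n.
have q0 : 0 < q by rewrite exprn_gt0.
have x0 : 0 < x by rewrite exprn_gt0.
pose a := (m * q)^-1.
have Es : gnp_expectation p (fun G => (clique_edges s \subset G)%:R) = x.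
  by rewrite gnp_prob_edges ?clique_edges_subpairs // card_clique_edges sk.
have Ev v : v \in A ->
    gnp_expectation p (fun G => (clique_edges s :|: star s v \subset G)%:R) = x * q.
  move=> /AE vs; rewrite gnp_prob_edges; last first.
    by rewrite finset.subUset clique_edges_subpairs star_subpairs.
  by rewrite cardsU_disjoint ?disjoint_edges_star // card_clique_edges card_star //
    sk exprD.
have Evw v w : v \in A -> w \in A -> v != w ->
    gnp_expectation p (fun G =>
      (clique_edges s :|: star s v :|: star s w \subset G)%:R) = x * q * q.
  move=> /AE vs /AE ws vw; rewrite gnp_prob_edges; last first.
    by rewrite !finset.subUset clique_edges_subpairs !star_subpairs.
  rewrite !cardsU_disjoint ?disjoint_edges_star //.
    by rewrite card_clique_edges !card_star // sk exprD exprD.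
  by rewrite -finset.setI_eq0 finset.setIUl finset.setU_eq0 !finset.setI_eq0
    disjoint_edges_star ?disjoint_star.
(* [Y] is the indicator of the face [s] times [(1 - a * N) ^+ 2], expanded into indicators of edge
   sets; [a] is the inverse of the mean of [N]. *)
pose Y G : R := (clique_edges s \subset G)%:R +
  ((- (2 * a)) * (\sum_(v in A) (clique_edges s :|: star s v \subset G)%:R) +
   a ^+ 2 * (\sum_(v in A) \sum_(w in A)
     (clique_edges s :|: star s v :|: star s w \subset G)%:R)).
apply: le_trans (_ : gnp_expectation p Y <= _).
  apply: le_gnp_expectation => G; rewrite /Y.
  have [sG|sG] := boolP (clique_edges s \subset G); last first.
    have sUG B : (clique_edges s :|: B \subset G) = false.
      by rewrite finset.subUset (negbTE sG).
    rewrite /= big1 => [|v _]; last by rewrite sUG.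
    rewrite big1 => [|v _]; last by rewrite big1 // => w _; rewrite -finset.setUA sUG.
    by rewrite !mulr0 !addr0.
  set N : R := \sum_(v in A) (star s v \subset G)%:R.
  rewrite (eq_bigr (fun v => (star s v \subset G)%:R)) -/N; last first.
    by move=> v _; rewrite finset.subUset sG.
  rewrite [X in a ^+ 2 * X](_ : _ = N ^+ 2); last first.
    rewrite expr2 mulr_suml; apply: eq_bigr => v _; rewrite mulr_sumr.
    by apply: eq_bigr => w _; rewrite !finset.subUset sG /= -natrM mulnb.
  rewrite (_ : true%:R + _ = (1 - a * N) ^+ 2); last by rewrite /=; ring.
  case: forall_inP => [noN|_]; last by rewrite sqr_ge0.
  rewrite /N big1 ?mulr0 ?subr0 ?expr1n // => v vA.
  by rewrite (negbTE (noN v vA)).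
rewrite /Y !gnp_expectationD !gnp_expectationZ !gnp_expectation_sum Es.
rewrite (eq_bigr (fun=> x * q) Ev) sumr_const -(mulr_natr (x * q)) -/m.
set S := \sum_(v in A) _.
(* For each [v] the diagonal term is [x * q], and the [m - 1] others, each [x * q * q], are counted
   as [m]. *)
have SE : S <= m * (x * q + m * (x * q * q)).
  rewrite /S /m mulr_natl -sumr_const; apply: ler_sum => v vA.
  rewrite gnp_expectation_sum (bigD1 v) //=.
  apply: lerD; first by rewrite -finset.setUA finset.setUid Ev.
  rewrite mulr_natl -sumr_const [X in _ <= X](bigD1 v) //=.
  rewrite (eq_bigr (fun=> x * q * q)); last first.
    by move=> w /andP[wA wv]; rewrite Evw // eq_sym.
  by rewrite lerDr !mulr_ge0 // ltW.
(* Since [a * m * q = 1], the right side is [x - 2x + x] plus [x * a]: only the diagonal part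
   survives. *)
have -> : x * (m * q)^-1 = x + (- (2 * a) * (x * q * m) +
    a ^+ 2 * (m * (x * q + m * (x * q * q)))).
  by rewrite /a; field; rewrite !gt_eqF.
by rewrite !lerD2l; apply: ler_wpM2l => //; rewrite sqr_ge0.
Qed.

Lemma expected_betti_le_cone (A : {set 'I_n}) : (0 < #|A|)%N -> 0 < p ->
  expected_betti n p k <=
  (k.+1%:R * (#|A|%:R / n%:R) + (#|A|%:R * p ^+ k.+1)^-1) * expected_faces n p k.
Proof.
move=> A0 p0; rewrite expected_facesE.
set x := p ^+ 'C(k.+1, 2); set a := (_ * p ^+ k.+1)^-1.
have x0 : 0 < x by rewrite exprn_gt0.
have a0 : 0 < a by rewrite invr_gt0 mulr_gt0 ?ltr0n ?exprn_gt0.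
have n0 : 0 < n%:R :> R.
  by rewrite ltr0n; apply: leq_trans A0 _; rewrite -[leqRHS](card_ord n) max_card.
pose Z (G : {set {set 'I_n}}) : R := \sum_(s : {set 'I_n} | #|s| == k.+1)
  ((clique_edges s \subset G) &&
    (~~ [disjoint s & A] || [forall v in A, ~~ (star s v \subset G)]))%:R.
apply: le_trans (_ : gnp_expectation p Z <= _).
  apply: le_gnp_expectation => G.
  by rewrite /Z -card_faces_sum ler_nat betti_le_cone.
rewrite /Z gnp_expectation_sum.
(* Sets [s] meeting [A] are charged the full probability [x] of being a face; [x * a] is charged to
   every [s], which keeps that sum uniform. *)
apply: le_trans (_ : \sum_(s : {set 'I_n} | #|s| == k.+1)
  ((~~ [disjoint s & A])%:R * x + x * a) <= _).
  apply: ler_sum => s /eqP sk; case: (boolP [disjoint s & A]) => sA /=.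
    by rewrite mul0r add0r; exact: expected_no_common_neighbour.
  rewrite mul1r; apply: le_trans (_ : x <= _); last by rewrite lerDl mulr_ge0 // ltW.
  rewrite /x -sk -card_clique_edges -gnp_prob_edges ?clique_edges_subpairs //.
  by apply: le_gnp_expectation => G; rewrite andbT.
rewrite big_split /= -mulr_suml sumr_const card_ksubsets.
rewrite mulrDl; apply: lerD; last by rewrite -(mulr_natl (x * a)) (mulrC x) mulrCA.
rewrite [X in _ <= X]mulrA; apply: ler_wpM2r; first exact: ltW.
rewrite mulrA mulrAC ler_pdivlMr //.
rewrite -natr_sum -!natrM ler_nat mulnC [(k.+1 * _)%N]mulnC -mulnA.
apply: leq_trans (card_subsets_meeting A); rewrite -sum1dep_card big_mkcondr /=.
by rewrite leq_mul2l leq_sum ?orbT // => s _; case: ([disjoint s & A]).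
Qed.

End Expectation.
End Combinatorics.

Local Open Scope classical_set_scope.

(** * The ratio of expectations and its limit *)

Section Ratio.
Context {R : realFieldType}.
Variables (n k : nat) (p : R).
Hypothesis p01 : 0 <= p <= 1.

Lemma expected_ratio_ge0 : 0 <= expected_betti n p k / expected_faces n p k.
Proof.
by rewrite divr_ge0 //; apply: sumr_ge0 => G _; rewrite mulr_ge0 ?gnp_prob_ge0.
Qed.

Lemma expected_ratio_le (c : R) : 0 <= c ->
  expected_betti n p k <= c * expected_faces n p k ->
  expected_betti n p k / expected_faces n p k <= c.
Proof.
move=> c0 bc; have : 0 <= expected_faces n p k.
  by apply: sumr_ge0 => G _; rewrite mulr_ge0 ?gnp_prob_ge0.
(* If the expected number of faces is 0, for instance when [n <= k], the quotient is 0 by the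
   convention on division, hence at most [c]. *)
rewrite le_eqVlt => /predU1P[<-|f0]; first by rewrite invr0 mulr0.
by rewrite ler_pdivrMr.
Qed.

(** Take [A] to be the first [n %/ L] vertices: a proportion at most [1 / L] and, since rounding
    down a quotient that is at least 1 loses less than half of it, at least [1 / L.*2]. *)
Lemma expected_ratio_le_cone (L : nat) : (0 < L <= n)%N -> 0 < p ->
  expected_betti n p k / expected_faces n p k <=
  k.+1%:R / L%:R + L.*2%:R / (p ^+ k.+1 * n%:R).
Proof.
move=> /andP[L0 Ln] p0; pose M := (n %/ L)%N.
have M0 : (0 < M)%N by rewrite divn_gt0.
have n0 : (0 < n)%N by exact: leq_trans Ln.
have Mn : (M <= n)%N by exact: leq_div.
pose A := [set i : 'I_n | (i < M)%N]%SET.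
have AM : #|A| = M.
  have inj : injective (widen_ord Mn) by move=> i j /(congr1 val) H; exact: val_inj.
  rewrite -[RHS]card_ord -(card_imset _ inj); apply: eq_card => i.
  rewrite inE; apply/idP/imsetP => [iM|[j _ ->]]; last exact: (ltn_ord j).
  by exists (Ordinal iM) => //; exact: val_inj.
have q0 : 0 < p ^+ k.+1 by rewrite exprn_gt0.
have := @expected_betti_le_cone R n k p p01 A; rewrite AM => /(_ M0 p0) H.
apply: le_trans (expected_ratio_le _ H) _.
  by rewrite addr_ge0 ?invr_ge0 ?mulr_ge0 ?invr_ge0 // ltW.
apply: lerD.
  apply: ler_wpM2l => //; rewrite ler_pdivrMr ?ltr0n // mulrC ler_pdivlMr ?ltr0n //.
  by rewrite -natrM ler_nat leq_trunc_div.
rewrite ler_pdivlMr ?mulr_gt0 ?ltr0n // mulrC ler_pdivrMr ?mulr_gt0 ?ltr0n //.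
rewrite mulrC mulrA; apply: ler_wpM2r; first exact: ltW.
rewrite -natrM ler_nat -doubleMl -muln2 -mulnA mulnC.
apply: ltnW; apply: leq_trans (ltn_ceil n L0) _.
by rewrite leq_mul2r muln2 -addnn -addn1 leq_add2l M0 orbT.
Qed.

End Ratio.

Theorem theorem3p9 (R : realType) (k : nat) (p : nat -> R)
    (hk : (1 <= k)%N)
    (hp01 : forall n : nat, 0 <= p n <= 1)
    (hp : (p n ^+ k.+1 * n%:R @[n --> \oo] --> +oo) \/
          (p n ^+ k * n%:R @[n --> \oo] --> (0 : R))) :
  expected_betti n (p n) k / expected_faces n (p n) k @[n --> \oo] --> (0 : R).
Proof.
case: hp => hp; last first.
  (* When [p^k n] tends to 0, the ratio is squeezed between 0 and [k.+1] times that quantity. *)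
  apply: (@squeeze_cvgr _ _ _ _ (fun=> 0) (fun n => k.+1%:R * (p n ^+ k * n%:R))).
  - near=> n; apply/andP; split; first exact: expected_ratio_ge0.
    apply: expected_ratio_le => //; last exact: expected_betti_le_adjacent.
    by have /andP[pn0 _] := hp01 n; rewrite !mulr_ge0 // exprn_ge0.
  - exact: cvg_cst.
  - rewrite -[X in _ --> X](mulr0 k.+1%:R); apply: cvgM => //; exact: cvg_cst.
apply/cvgrPdist_le => e e0.
(* This [L] brings the term [k.+1 / L] down to [e / 2]; it does not depend on [n], so the other term
   vanishes in the limit. *)
pose L := (Num.truncn (k.+1%:R * 2 / e)).+1.
have Le : k.+1%:R / L%:R <= e / 2.
  rewrite ler_pdivrMr ?ltr0n // mulrAC ler_pdivlMr // [leRHS]mulrC -ler_pdivrMr //.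
  by rewrite ltW // truncnS_gt.
have L0 : (0 < L)%N by [].
near=> n.
rewrite sub0r normrN ger0_norm ?expected_ratio_ge0 //.
(* This threshold is what bounds the second term by [e / 2]; being positive, it also forces [p n] to
   be positive. *)
have qn : L.*2%:R / (e / 2) <= p n ^+ k.+1 * n%:R.
  by near: n; move/cvgryPge: hp; apply.
have qn0 : 0 < p n ^+ k.+1 * n%:R.
  by apply: lt_le_trans qn; rewrite !divr_gt0 // ltr0n double_gt0.
have pn0 : 0 < p n.
  have /andP[pn0 _] := hp01 n; rewrite lt_def pn0 andbT.
  by apply: contraTneq qn0 => ->; rewrite expr0n /= mul0r ltxx.
have Ln : (0 < L <= n)%N by rewrite L0 /=; near: n; exact: nbhs_infty_ge.
apply: le_trans (expected_ratio_le_cone k (hp01 n) Ln pn0) _.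
rewrite [leRHS]splitr; apply: lerD => //.
by rewrite ler_pdivrMr // mulrC -ler_pdivrMr // divr_gt0.
Unshelve. all: by end_near.
Qed.
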